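(* For any integer $\ell\geq 3$ there exists a graph $G$ with an edge $e$ such that $\gamma_g(G)=\ell$ and $\gamma_g(G-e)=\ell-1$.
   Context: Graphs are finite, simple and undirected. A vertex dominates itself and all its neighbors. The domination game on a graph $G$ is played by two players, Dominator and Staller, who alternately choose a vertex of $G$ such that each chosen vertex dominates at least one vertex that was not dominated by the previously chosen vertices. The game ends when all vertices of $G$ are dominated. Dominator wants the total number of chosen vertices to be as small as possible, Staller wants it to be as large as possible. Assuming both play optimally, $\gamma_g(G)$ (the game domination number) is the total number of vertices chosen when Dominator moves first. $G-e$ denotes the graph obtained from $G$ by removing the edge $e$ (keeping all vertices). *)

(* Defs.v *)
From mathcomp Require Import all_boot.

Set Implicit Arguments.
Unset Strict Implicit.
Unset Printing Implicit Defensive.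

Record sgraph := SGraph {
  vertex :> finType;
  adj : rel vertex;
  adj_sym : symmetric adj;
  adj_irrefl : irreflexive adj }.

Section DeleteEdge.
Variables (G : sgraph) (x y : G).

Definition del_edge_rel : rel G :=
  fun u v => adj u v && ([set u; v] != [set x; y]).

Lemma del_edge_sym : symmetric del_edge_rel.
Proof. by move=> u v; rewrite /del_edge_rel adj_sym setUC. Qed.

Lemma del_edge_irrefl : irreflexive del_edge_rel.
Proof. by move=> u; rewrite /del_edge_rel adj_irrefl. Qed.

Definition del_edge : sgraph := SGraph del_edge_sym del_edge_irrefl.

End DeleteEdge.

Section DominationGame.
Variable G : sgraph.

Definition closed_nbhd (v : G) : {set G} := [set u | (u == v) || adj v u].

Definition dominated (S : {set G}) : {set G} := \bigcup_(v in S) closed_nbhd v.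

Definition legal_move (S : {set G}) (v : G) : bool :=
  ~~ (closed_nbhd v \subset dominated S).

Inductive player := Dominator | Staller.

(* Number of further moves under optimal play, when the vertices of [S] have
   been chosen and [p] is to move.  Each legal move dominates a new vertex, so
   [fuel] is never exhausted as long as it is at least the number of
   undominated vertices.  The value computed with fuel [m] is at most [m], and
   an unfinished game always has a legal move, so the default value [m] of the
   minimum never affects it. *)
Fixpoint game_value (fuel : nat) (p : player) (S : {set G}) : nat :=
  if fuel is m.+1 then
    if dominated S == [set: G] then 0
    else match p with
         | Dominator =>
             (\big[minn/m]_(v | legal_move S v)
                game_value m Staller (v |: S)).+1
         | Staller =>
             (\max_(v | legal_move S v)
                game_value m Dominator (v |: S)).+1
         end
  else 0.

Definition gamma_g : nat := game_value #|G| Dominator set0.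

End DominationGame.

(* Main.v *)
(* The path on five vertices satisfies the claim for l = 3: removing an inner
   edge leaves P2 and P3, and Dominator starts at the centre of P3.  The same
   path with one additional isolated vertex works for l = 4.  These two cases
   are finite computations.  Adding two isolated vertices to any graph raises
   the game domination number by exactly 2, since each player can answer a move
   on one of them by a move on the other; hence induction on l in steps of 2. *)
Require Import Defs.
From mathcomp Require Import all_boot.
From mathcomp Require Import zify.

Set Implicit Arguments.
Unset Strict Implicit.
Unset Printing Implicit Defensive.

(** * Minima with a default value *)

Lemma bigminn_le_idx (I : Type) (r : seq I) (P : pred I) (F : I -> nat) m :
  \big[minn/m]_(i <- r | P i) F i <= m.
Proof.
by elim/big_rec: _ => // i k _ le_km; rewrite geq_min le_km orbT.
Qed.

Lemma bigminn_le (I : finType) (P : pred I) (F : I -> nat) m i :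
  P i -> \big[minn/m]_(j | P j) F j <= F i.
Proof.
move=> Pi; have := mem_index_enum i.
elim: (index_enum I) => // j r IHr; rewrite inE big_cons => /orP[/eqP<-|/IHr le_r].
  by rewrite Pi geq_minl.
by case: ifP => // _; rewrite geq_min le_r orbT.
Qed.

(** The default needs its own bound: [minn] has no neutral element on [nat], so [m] takes part in
    every such minimum. *)
Lemma le_bigminn (I : finType) (P : pred I) (F : I -> nat) m k :
  k <= m -> (forall i, P i -> k <= F i) -> k <= \big[minn/m]_(i | P i) F i.
Proof. by move=> km kF; elim/big_ind: _ => // a b; rewrite leq_min => -> ->. Qed.

Lemma eq_set2 (T : finType) (a b c d : T) :
  ([set a; b] == [set c; d]) = (a == c) && (b == d) || (a == d) && (b == c).
Proof.
rewrite eqEsubset !subUset !sub1set !inE ![c == _]eq_sym ![d == _]eq_sym.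
by do 4!case: (_ == _).
Qed.

(** * Legal moves and edge deletion in an arbitrary graph *)

Section Graph.
Variable G : sgraph.
Implicit Types (S : {set G}) (u v x y : G).

Lemma dominatedU1 v S : dominated (v |: S) = closed_nbhd v :|: dominated S.
Proof. by rewrite /dominated bigcup_setU big_set1. Qed.

Lemma sub_dominated S : S \subset dominated S.
Proof. by apply/subsetP => v vS; apply/bigcupP; exists v; rewrite // inE eqxx. Qed.

Lemma legal_notin S v : legal_move S v -> v \notin S.
Proof. by apply: contra => vS; apply: bigcup_sup. Qed.

Lemma game_valueS m p S :
  game_value m.+1 p S =
    if dominated S == setT then 0
    else match p with
         | Dominator =>
             (\big[minn/m]_(v | legal_move S v) game_value m Staller (v |: S)).+1
         | Staller =>
             (\max_(v | legal_move S v) game_value m Dominator (v |: S)).+1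
         end.
Proof. by []. Qed.

Lemma legal_exists S : dominated S != setT -> exists v, legal_move S v.
Proof.
rewrite eqEsubset subsetT /= => /subsetPn[v _ vD]; exists v.
by apply/subsetPn; exists v; rewrite // inE eqxx.
Qed.

Lemma legal_moveE S v :
  legal_move S v = [exists u, (u \in closed_nbhd v) && (u \notin dominated S)].
Proof.
by apply/subsetPn/existsP => [[u uv uS]|[u /andP[uv uS]]]; exists u; rewrite ?uv.
Qed.

Lemma del_edge_relE x y u v :
  del_edge_rel x y u v =
    adj u v && ~~ ((u == x) && (v == y) || (u == y) && (v == x)).
Proof. by rewrite /del_edge_rel eq_set2. Qed.

End Graph.

(** * Adding two isolated vertices *)

Section AddTwoIsolated.
Variable G : sgraph.
Implicit Types (S : {set G}) (B : {set bool}).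

Definition sum_bool_rel (a b : G + bool) : bool :=
  match a, b with inl u, inl v => adj u v | _, _ => false end.

Lemma sum_bool_sym : symmetric sum_bool_rel.
Proof. by move=> [u|b] [v|c] //=; apply: adj_sym. Qed.

Lemma sum_bool_irrefl : irreflexive sum_bool_rel.
Proof. by move=> [u|b] //=; apply: adj_irrefl. Qed.

Definition add2_isolated : sgraph := SGraph sum_bool_sym sum_bool_irrefl.

(* Working with any [e =2 sum_bool_rel] covers both [add2_isolated] and its
   edge-deleted subgraphs without function extensionality. *)
Variables (e : rel (G + bool)%type) (e_sym : symmetric e) (e_irr : irreflexive e).
Hypothesis eE : e =2 sum_bool_rel.

Let U := SGraph e_sym e_irr.

(** Positions on the enlarged graph are kept split in this form, so that domination and legality can
    be decided componentwise: the isolated vertices interact with nothing. *)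
Definition sum_set (S : {set G}) (B : {set bool}) : {set U} :=
  [set z | match z with inl v => v \in S | inr b => b \in B end].

Lemma dominated_sum_set S B : dominated (sum_set S B) = sum_set (dominated S) B.
Proof.
apply/setP => -[u|b]; rewrite inE; apply/bigcupP/idP.
- case=> -[v|c]; rewrite !inE /= eE //= => vS uv.
  by apply/bigcupP; exists v; rewrite // inE.
- case/bigcupP=> v vS; rewrite inE => uv.
  by exists (inl v); rewrite !inE //= eE.
- by case=> -[v|c]; rewrite !inE /= eE //= orbF => cB /eqP[->].
- by move=> bB; exists (inr b); rewrite !inE ?eqxx.
Qed.

Lemma sum_set_eqT S B :
  (sum_set S B == setT) = (S == setT) && (B == setT).
Proof.
apply/eqP/andP => [ST | [/eqP-> /eqP->]]; last by apply/setP => -[v|b]; rewrite !inE.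
split; apply/eqP/setP => z; rewrite inE.
  by have /setP/(_ (inl z)) := ST; rewrite !inE.
by have /setP/(_ (inr z)) := ST; rewrite !inE.
Qed.

Lemma legal_inl S B v : legal_move (sum_set S B) (inl v : U) = legal_move S v.
Proof.
rewrite !legal_moveE dominated_sum_set; apply/existsP/existsP.
  by case=> -[u|b]; rewrite !inE /= eE //= => uv; exists u; rewrite inE.
by case=> u; rewrite inE => uv; exists (inl u); rewrite !inE /= eE.
Qed.

Lemma legal_inr S B b : legal_move (sum_set S B) (inr b : U) = (b \notin B).
Proof.
rewrite legal_moveE dominated_sum_set; apply/existsP/idP.
  by case=> -[u|c]; rewrite !inE /= eE //= orbF => /andP[/eqP[->]].
by move=> bB; exists (inr b); rewrite !inE eqxx.
Qed.

Lemma sum_setU1l S B v : (inl v : U) |: sum_set S B = sum_set (v |: S) B.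
Proof. by apply/setP => -[u|b]; rewrite !inE. Qed.

Lemma sum_setU1r S B b : (inr b : U) |: sum_set S B = sum_set S (b |: B).
Proof. by apply/setP => -[u|c]; rewrite !inE. Qed.

Lemma setU1_negb b : ~~ b |: [set b] = setT.
Proof. by apply/setP => -[]; rewrite !inE; case: b. Qed.

Lemma set1_bool_neqT (b : bool) : ([set b] == setT) = false.
Proof. by apply/eqP => /setP/(_ (~~ b)); rewrite !inE; case: b. Qed.

Lemma set0_bool_neqT : ((set0 : {set bool}) == setT) = false.
Proof. by apply/eqP => /setP/(_ true); rewrite !inE. Qed.

(** With both isolated vertices chosen, the legal moves are exactly those of [G], so the two game
    trees coincide at every fuel. *)
Lemma game_sum_setT m p S : game_value m p (sum_set S setT) = game_value m p S.
Proof.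
elim: m p S => //= m IHm p S.
rewrite dominated_sum_set sum_set_eqT eqxx andbT; case: eqP => // _.
case: p; congr _.+1; apply/eqP; rewrite eqn_leq; apply/andP; split.
- apply: le_bigminn => [|v vS]; first exact: bigminn_le_idx.
  by rewrite -IHm -sum_setU1l; apply: bigminn_le; rewrite legal_inl.
- apply: le_bigminn => [|[v|b]]; first exact: bigminn_le_idx.
    by rewrite legal_inl sum_setU1l IHm => vS; apply: bigminn_le.
  by rewrite legal_inr inE.
- apply/bigmax_leqP => -[v|b]; last by rewrite legal_inr inE.
  rewrite legal_inl sum_setU1l IHm => vS.
  exact: (leq_bigmax_cond (F := fun v => game_value m Dominator (v |: S))).
- apply/bigmax_leqP => v vS; rewrite -IHm -sum_setU1l.
  by apply: (leq_bigmax_cond (F := fun v : U => game_value m Dominator (v |: _)));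
    rewrite legal_inl.
Qed.

(** Staller can take the last isolated vertex and leave Dominator to move on [S]. This is the reply
    to Dominator playing the first one. *)
Lemma game_Staller_set1_ge m S b :
  (game_value m Dominator S).+1 <= game_value m.+1 Staller (sum_set S [set b]).
Proof.
rewrite game_valueS dominated_sum_set sum_set_eqT set1_bool_neqT andbF ltnS.
rewrite -game_sum_setT -(setU1_negb b) -sum_setU1r.
apply: (leq_bigmax_cond (F := fun v : U => game_value m Dominator (v |: _))).
by rewrite legal_inr inE; case: b.
Qed.

(** The same reply with the roles exchanged, giving an upper bound. *)
Lemma game_Dominator_set1_le m S b :
  game_value m.+1 Dominator (sum_set S [set b]) <= (game_value m Staller S).+1.
Proof.
rewrite game_valueS dominated_sum_set sum_set_eqT set1_bool_neqT andbF ltnS.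
rewrite -game_sum_setT -(setU1_negb b) -sum_setU1r.
by apply: bigminn_le; rewrite legal_inr inE; case: b.
Qed.

Lemma game_value_end m p S : dominated S = setT -> game_value m p S = 0.
Proof. by move=> ST; case: m => //= m; rewrite ST eqxx. Qed.

Lemma legal_end S v : dominated S = setT -> legal_move S v = false.
Proof. by rewrite /legal_move => ->; rewrite subsetT. Qed.

Lemma game_set1_end m p S b : dominated S = setT ->
  game_value m.+1 p (sum_set S [set b]) = 1.
Proof.
move=> ST; rewrite game_valueS dominated_sum_set sum_set_eqT set1_bool_neqT andbF.
have nbP: legal_move (sum_set S [set b]) (inr (~~ b) : U).
  by rewrite legal_inr inE; case: b.
case: p; congr _.+1; apply/eqP; rewrite -leqn0.
  apply: leq_trans (bigminn_le _ _ nbP) _.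
  by rewrite sum_setU1r setU1_negb game_sum_setT game_value_end.
apply/bigmax_leqP => -[v|c]; first by rewrite legal_inl legal_end.
rewrite legal_inr inE => cb; have ->: c = ~~ b by case: b {nbP} cb; case: c.
by rewrite sum_setU1r setU1_negb game_sum_setT game_value_end.
Qed.

(** Endgame, where [G] offers no move to compare with: only the isolated vertices are legal, and
    they are taken one after the other. *)
Lemma game_set0_end m p S : dominated S = setT ->
  game_value m.+2 p (sum_set S set0) = 2.
Proof.
move=> ST; rewrite game_valueS dominated_sum_set sum_set_eqT set0_bool_neqT andbF.
have moveE b q : game_value m.+1 q ((inr b : U) |: sum_set S set0) = 1.
  by rewrite sum_setU1r setU0 game_set1_end.
have tP: legal_move (sum_set S set0) (inr true : U) by rewrite legal_inr inE.
case: p; congr _.+1; apply/eqP; rewrite eqn_leq; apply/andP; split.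
- by rewrite -(moveE true Staller); apply: bigminn_le.
- apply: le_bigminn => // -[v|b]; first by rewrite legal_inl legal_end.
  by rewrite moveE.
- apply/bigmax_leqP => -[v|b]; first by rewrite legal_inl legal_end.
  by rewrite moveE.
- rewrite -(moveE true Dominator).
  exact: (leq_bigmax_cond (F := fun v : U => game_value m.+1 Dominator (v |: _))).
Qed.

(** A move in [G] is handled by induction, a move on an isolated vertex by the reply on the other
    one. A legal move is never in [S], so it enlarges [S] and the fuel bound survives the loss of
    one unit; at fuel 0 it forces [S] to be everything. *)
Lemma game_set0 m p S : #|G| <= m + #|S| ->
  game_value m.+2 p (sum_set S set0) = (game_value m p S).+2.
Proof.
elim: m p S => [|m IHm] p S fuelP.
  rewrite game_set0_end //; apply/eqP; rewrite -subTset.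
  apply: subset_trans (sub_dominated S).
  by rewrite subTset eqEcard subsetT cardsT.
have [ST | ST] := eqVneq (dominated S) setT.
  by rewrite game_set0_end // game_value_end.
have IH q v : legal_move S v ->
    game_value m.+2 q ((inl v : U) |: sum_set S set0) = (game_value m q (v |: S)).+2.
  move=> vS; rewrite sum_setU1l IHm // cardsU1 (legal_notin vS).
  by rewrite add1n addnS -addSn.
have IHb q b : game_value m.+2 q ((inr b : U) |: sum_set S set0)
    = game_value m.+2 q (sum_set S [set b]) by rewrite sum_setU1r setU0.
have St_ge b := game_Staller_set1_ge m.+1 S b.
have Dom_le b := game_Dominator_set1_le m.+1 S b.
rewrite game_valueS dominated_sum_set sum_set_eqT set0_bool_neqT andbF.
case: p.
- rewrite game_valueS (negbTE ST) in St_ge *; congr _.+1.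
  apply/eqP; rewrite eqn_leq; apply/andP; split.
    (* The 2 moves to the left as a truncated subtraction, so that the right side is a bare minimum.
       The defaults [m.+2] and [m] also differ by 2. *)
    rewrite -[leqRHS]add2n -leq_subLR; apply: le_bigminn => [|v vS].
      by rewrite leq_subLR; apply: bigminn_le_idx.
    by rewrite leq_subLR add2n -IH //; apply: bigminn_le; rewrite legal_inl.
  apply: le_bigminn => [|[v|b]]; first by rewrite !ltnS bigminn_le_idx.
    by rewrite legal_inl => vS; rewrite IH // !ltnS bigminn_le.
  by rewrite IHb.
- rewrite game_valueS (negbTE ST) in Dom_le *; congr _.+1.
  apply/eqP; rewrite eqn_leq; apply/andP; split.
    apply/bigmax_leqP => -[v|b]; last by rewrite IHb.
    rewrite legal_inl => vS; rewrite IH // !ltnS.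
    exact: (leq_bigmax_cond (F := fun v => game_value m Dominator (v |: S))).
  (* An empty maximum would be 0 and lose the added 2, so an optimal move of Staller in [G] must
     actually be exhibited. *)
  have [v vS] := legal_exists ST.
  rewrite (bigmax_eq_arg _ vS); case: arg_maxnP => // w wS _.
  rewrite -IH //.
  by apply: (leq_bigmax_cond (F := fun v : U => game_value m.+2 Dominator (v |: _)));
    rewrite legal_inl.
Qed.

Lemma gamma_g_add2 : gamma_g U = (gamma_g G).+2.
Proof.
rewrite /gamma_g card_sum card_bool addn2 -game_set0 ?leq_addr //.
by congr game_value; apply/setP => -[v|b]; rewrite !inE.
Qed.

End AddTwoIsolated.

(** * Evaluating the game on vertices numbered from 0 *)

Section Compute.
Variables (n : nat) (a : rel nat).

Definition nat_dom (v i : nat) : bool := (i == v) || a v i.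

(* The game in terms of the list [u] of undominated vertices, in a form that
   evaluates by computation. *)
Fixpoint list_value (fuel : nat) (p : player) (u : seq nat) : nat :=
  if fuel is m.+1 then
    if nilp u then 0
    else let next q := [seq list_value m q [seq i <- u | ~~ nat_dom v i]
                       | v <- iota 0 n & has (nat_dom v) u] in
         match p with
         | Dominator => (foldr minn m (next Staller)).+1
         | Staller => (foldr maxn 0 (next Dominator)).+1
         end
  else 0.

Variables (e : rel 'I_n) (e_sym : symmetric e) (e_irr : irreflexive e).
Hypothesis eE : forall i j, e i j = a i j.

Let G := SGraph e_sym e_irr.

(** Since [op] and [idx] are arbitrary, this serves both Dominator's minimum with its default and
    Staller's maximum. *)
Lemma big_iota_ord (op : nat -> nat -> nat) idx (P : pred G) (Q : pred nat)
    (F : G -> nat) (H : nat -> nat) :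
    (forall i : 'I_n, P i = Q i) -> (forall i : 'I_n, P i -> F i = H i) ->
  \big[op/idx]_(i | P i) F i = foldr op idx [seq H i | i <- iota 0 n & Q i].
Proof.
move=> PQ FH; rewrite (eq_bigr (fun i : 'I_n => H i)) //.
rewrite (eq_bigl (fun i : 'I_n => Q i)) // -(big_mkord Q H) /index_iota subn0.
elim: (iota 0 n) => [|i r IHr]; first by rewrite big_nil.
by rewrite big_cons /= IHr; case: (Q i).
Qed.

(** The value depends on [S] only through the undominated vertices, and a move [v] removes from them
    precisely what [v] dominates. *)
Lemma game_value_list m p (S : {set G}) (u : seq nat) :
    {subset u <= iota 0 n} ->
    (forall i : 'I_n, (val i \in u) = (i \notin dominated S)) ->
  game_value m p S = list_value m p u.
Proof.
elim: m p S u => //= m IHm p S u uI uS.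
have -> : nilp u = (dominated (G := G) S == setT).
  apply/nilP/eqP => [u0 | ST].
    by apply/setP => i; rewrite inE; apply/negbNE; rewrite -uS u0.
  case: u uI uS => // i u uI uS; have := uI i (mem_head _ _).
  rewrite mem_iota => /= lt_in; have := uS (Ordinal lt_in).
  by rewrite ST mem_head inE.
case: (_ == _) => //.
have legalE (v : 'I_n) : legal_move (G := G) S v = has (nat_dom v) u.
  rewrite legal_moveE; apply/existsP/hasP.
    case=> i /andP[]; rewrite inE /= eE => iv iS.
    by exists (val i); rewrite ?uS.
  case=> i iu iv; have := uI i iu; rewrite mem_iota /= => lt_in.
  by exists (Ordinal lt_in); rewrite -uS /= iu inE /= eE andbT.
have nextE q (v : 'I_n) : game_value (G := G) m q (v |: S)
    = list_value m q [seq i <- u | ~~ nat_dom v i].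
  apply: IHm => [i|i]; first by rewrite mem_filter => /andP[_ /uI].
  by rewrite mem_filter uS dominatedU1 !inE negb_or /= eE.
by case: p; congr _.+1; apply: big_iota_ord => // v _; apply: nextE.
Qed.

Lemma gamma_g_list : gamma_g G = list_value n Dominator (iota 0 n).
Proof.
rewrite /gamma_g card_ord; apply: game_value_list => // i.
by rewrite /dominated big_set0 inE mem_iota /= ltn_ord.
Qed.

End Compute.

(** * The path on five vertices and the theorem *)

Definition path5 (i j : nat) : bool :=
  [&& i < 5, j < 5 & (i.+1 == j) || (j.+1 == i)].

Definition path5_cut (i j : nat) : bool :=
  path5 i j && ~~ ((i == 1) && (j == 2) || (i == 2) && (j == 1)).

Lemma path5_sym n : symmetric (fun i j : 'I_n => path5 i j).
Proof. by move=> i j; rewrite /path5 andbCA orbC. Qed.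

Lemma path5_irrefl n : irreflexive (fun i : 'I_n => path5 i).
Proof. by move=> i; rewrite /path5 orbb; lia. Qed.

(* For n >= 5, this is P5 together with n - 5 isolated vertices. *)
Definition path5_graph n : sgraph := SGraph (@path5_sym n) (@path5_irrefl n).

Lemma path5_del n (lt1n : 1 < n) (lt2n : 2 < n) :
  let x : path5_graph n := Ordinal lt1n in
  let y : path5_graph n := Ordinal lt2n in
  [/\ adj x y, gamma_g (path5_graph n) = list_value n path5 n Dominator (iota 0 n)
    & gamma_g (del_edge x y) = list_value n path5_cut n Dominator (iota 0 n)].
Proof.
move=> x y; split=> //; first exact: gamma_g_list.
by apply: gamma_g_list => i j; rewrite del_edge_relE.
Qed.

Theorem proposition2p3 (l : nat) (hl : 3 <= l) :
  exists (G : sgraph) (x y : G),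
    [/\ adj x y, gamma_g G = l & gamma_g (del_edge x y) = l.-1].
Proof.
have [k ->] : exists k, l = k.+3 by exists (l - 3); lia.
(* Strong induction, because the step goes from [k] to [k.+2]; 0 and 1 are the computed cases, on 5
   and 6 vertices. *)
elim/ltn_ind: k {l hl} => -[|[|k]] IHk.
- have [xy g3 g2] := @path5_del 5 isT isT.
  by do 3!eexists; split; [exact: xy | rewrite g3; vm_compute | rewrite g2; vm_compute].
- have [xy g4 g3] := @path5_del 6 isT isT.
  by do 3!eexists; split; [exact: xy | rewrite g4; vm_compute | rewrite g3; vm_compute].
have [|G [x [y [xy gG gGe]]]] := IHk k; first by lia.
exists (add2_isolated G), (inl x), (inl y); split=> //.
  by rewrite gamma_g_add2 // gG.
rewrite (_ : k.+4.+1.-1 = (k.+3.-1).+2) // -gGe.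
(* Deleting the edge after enlarging agrees only pointwise with enlarging after deleting, which is
   what the hypothesis [eE] asks for. *)
apply: (@gamma_g_add2 (del_edge x y)) => -[u|b] [v|c] //=.
all: by rewrite del_edge_relE //= del_edge_relE.
Qed.
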